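(* Let $F$ be the field of meromorphic functions on a complex domain $D\subseteq\mathbb{C}$, let $n,s\ge1$ and $\mathcal{M}=\begin{pmatrix}\mathcal{A}&\mathcal{B}\\\mathcal{C}&\mathcal{D}\end{pmatrix}\in F^{(n+s)\times(n+s)}$ with $\mathcal{A}\in F^{n\times n}$, $\mathcal{D}\in F^{s\times s}$. Let $\mathcal{X},\mathcal{Y}\in F^{n\times n}$ be regular (invertible over $F$), let $f\in F$, and let $\mathrm{a}(x)\in F[x]\setminus\{0\}$ satisfy $\mathrm{a}(f\mathbf{I}_n-\mathcal{X}\mathcal{A}\mathcal{Y})\equiv\mathbf{0}$. Set $$\mathcal{P}=\mathcal{Y}\,\mathrm{p}(f,f\mathbf{I}_n-\mathcal{X}\mathcal{A}\mathcal{Y};\mathrm{a})\,\mathcal{X},\qquad \mathcal{S}=\mathrm{a}(f)\,\mathcal{D}-\mathcal{C}\mathcal{P}\mathcal{B}\in F^{s\times s}.$$ Then: (i) every latent root of $\mathcal{A}$ is a root of $\mathrm{a}(f)$; (ii) every latent root of $\mathcal{M}$ is a latent root of $\mathcal{S}$ or of $\mathcal{A}$; (iii) every latent root of $\mathcal{S}$ which is not a root of $\mathrm{a}(f)$ is a latent root of $\mathcal{M}$.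
   Context: For a polynomial $\mathrm{a}(x)=\sum_{k=0}^{d}a_kx^k\in F[x]$, $f\in F$ and $\mathcal{Z}\in F^{n\times n}$: $\mathrm{p}(f,\mathcal{Z};\mathrm{a})=\sum_{k=1}^{d}a_k\sum_{i=1}^{k}f^{\,i-1}\mathcal{Z}^{k-i}$. Let $P\subset D$ be the set of points that are poles of $f$, of an entry of $\mathcal{M}$, $\mathcal{X}$ or $\mathcal{Y}$, or of a coefficient of $\mathrm{a}(x)$, and let $D_P=D\setminus P$. A latent root of a square matrix $\mathcal{Z}\in\{\mathcal{M},\mathcal{A},\mathcal{S}\}$ is a point $\lambda\in D_P$ with $\det(\mathcal{Z}(\lambda))=0$. A root of $\mathrm{a}(f)$ is a point $\lambda\in D_P$ at which the function $\mathrm{a}(f)\in F$ vanishes. *)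

(* Defs.v *)
From HB Require Import structures.
From mathcomp Require Import all_boot all_order all_algebra.
From mathcomp Require Import all_classical all_reals all_analysis.
From mathcomp Require Import complex.
From mathcomp Require Import ring lra.

Set Implicit Arguments.
Unset Strict Implicit.
Unset Printing Implicit Defensive.

Import Order.TTheory GRing.Theory Num.Theory.
Import numFieldNormedType.Exports.
Import ComplexField.Normc.
Local Open Scope classical_set_scope.
Local Open Scope ring_scope.
Local Open Scope complex_scope.

HB.instance Definition _ (R : realType) := NormedModule.copy R[i] (R[i]^o).

(* f is the sum of a power series centred at x on some disc around x. *)
Definition analytic_at (R : realType) (f : R[i] -> R[i]) (x : R[i]) : Prop :=
  exists (a : nat -> R[i]) (r : R), 0 < r /\
    forall z, `|z - x| < r%:C ->
      series (fun k => a k * (z - x) ^+ k) @ \oo --> f z.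

Definition holomorphic_at (R : realType) (f : R[i] -> R[i]) (x : R[i]) : Prop :=
  \forall y \near x, analytic_at f y.

(* The value of f at x itself is irrelevant: x^' is the punctured
   neighbourhood filter. *)
Definition pole_at (R : realType) (f : R[i] -> R[i]) (x : R[i]) : Prop :=
  exists (n : nat) (g : R[i] -> R[i]), [/\ holomorphic_at g x, g x != 0 &
    \forall z \near x^', f z = g z / (z - x) ^+ n.+1].

Record complexDomain (R : realType) := ComplexDomain {
  domain_set :> R[i] -> Prop;
  domain_open : open (domain_set : set R[i]);
  domain_connected : connected (domain_set : set R[i]);
  domain_nonempty : exists x, domain_set x
}.

(* A meromorphic function on D, i.e. one that at each point of D is holomorphic
   or has a pole, is represented by a total function with the dummy value 0 at
   its poles and outside D. With this normalization two meromorphic functions on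
   D are the same iff their representatives are equal. *)
Record meromorphic (R : realType) (D : complexDomain R) := Meromorphic {
  mero_fun :> R[i] -> R[i];
  mero_funP : forall x, D x ->
    holomorphic_at mero_fun x \/ (pole_at mero_fun x /\ mero_fun x = 0);
  mero_fun_out : forall x, ~ D x -> mero_fun x = 0
}.

Module MeromorphicLemmas.

Section Analytic.
Variable R : realType.
Local Notation C := R[i].
Local Notation m := (@normc R).
Implicit Types (f g : C -> C) (a b : nat -> C) (x z w : C).

Lemma normE z : `|z| = (m z)%:C. Proof. by []. Qed.

Lemma m_ge0 z : 0 <= m z.
Proof. by rewrite -lecR -normE normr_ge0. Qed.

Lemma mD z w : m (z + w) <= m z + m w.
Proof. by rewrite -lecR rmorphD /= -!normE ler_normD. Qed.

Lemma mN z : m (- z) = m z.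
Proof. by apply: complexI; rewrite -!normE normrN. Qed.

Lemma mX z n : m (z ^+ n) = m z ^+ n.
Proof. by apply: complexI; rewrite rmorphXn /= -!normE normrX. Qed.

Lemma m_sum n (F : nat -> C) : m (\sum_(i < n) F i) <= \sum_(i < n) m (F i).
Proof.
elim: n => [|n IH]; first by rewrite !big_ord0 normc0.
by rewrite !big_ord_recr /=; apply: (le_trans (mD _ _)); rewrite lerD2r.
Qed.

Lemma m_eq0 z : (m z == 0) = (z == 0).
Proof. by apply/eqP/eqP => [/eq0_normc//|->]; rewrite normc0. Qed.

Lemma m_real (t : R) : 0 <= t -> m t%:C = t.
Proof. by move=> t0; apply: complexI; rewrite -normE ger0_norm // lecR. Qed.

Lemma nbhsP x (P : set C) :
  nbhs x P <-> exists2 r : R, 0 < r & forall z, m (z - x) < r -> P z.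
Proof.
split.
  move=> /nbhs_ballP [e /= e0 H]; exists (complex.Re e).
    by move: e0; rewrite ltcE /= => /andP[].
  move=> z Hz; apply: H; rewrite /ball /= -(opprB z) normrN normE.
  have -> : e = (complex.Re e)%:C.
    by apply/esym/eqP; rewrite RRe_real // gtr0_real.
  by rewrite ltcR.
move=> [r r0 H]; apply/nbhs_ballP; exists r%:C; first by rewrite /= ltcR.
move=> z; rewrite /ball /= -(opprB z) normrN normE ltcR; exact: H.
Qed.

Lemma dnbhsP x (P : set C) :
  x^' P <-> exists2 r : R, 0 < r & forall z, z != x -> m (z - x) < r -> P z.
Proof.
split.
  move=> /nbhsP [r r0 H]; exists r => // z zx /H; exact.
by move=> [r r0 H]; apply/nbhsP; exists r => // z /[swap] zx /(H _ zx).
Qed.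

Definition psum a N w := \sum_(i < N) a i * w ^+ i.

Lemma psumS a N w : psum a N.+1 w = psum a N w + a N * w ^+ N.
Proof. by rewrite /psum big_ord_recr. Qed.

Lemma psum0 a w : psum a 0 w = 0.
Proof. by rewrite /psum big_ord0. Qed.

Definition expansion f x a (M p : R) :=
  [/\ 0 <= M, 0 < p & forall N w, m w < p ->
    m (f (x + w) - psum a N w) <= M * (m w / p) ^+ N].

Lemma geom_bound (t : R) n k : 0 <= t -> t <= 2^-1 ->
  \sum_(i < k) t ^+ (n + i) <= 2 * t ^+ n.
Proof.
move=> t0 t1.
have -> : \sum_(i < k) t ^+ (n + i) = t ^+ n * \sum_(i < k) t ^+ i.
  by rewrite big_distrr /=; apply: eq_bigr => i _; rewrite exprD.
rewrite mulrC ler_wpM2r ?exprn_ge0//.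
have := subrX1 t k; have := exprn_ge0 k t0.
have : 0 <= \sum_(i < k) t ^+ i by apply: sumr_ge0 => i _; exact: exprn_ge0.
nra.
Qed.

Lemma cvgC (u : nat -> C) (l : C) : u @ \oo --> l ->
  forall e : R, 0 < e -> exists N, forall n, (N <= n)%N -> m (l - u n) < e.
Proof.
move=> /cvgrPdist_lt H e e0.
have e0' : (0 : C) < e%:C by rewrite ltcR.
have [N _ HN] := H _ e0'.
by exists N => n /HN; rewrite normE ltcR.
Qed.

Lemma cvgCP (u : nat -> C) (l : C) :
  (forall e : R, 0 < e -> exists N, forall n, (N <= n)%N -> m (l - u n) < e) ->
  u @ \oo --> l.
Proof.
move=> H; apply/cvgrPdist_lt => e e0.
have eE : e = (complex.Re e)%:C.
  by apply/esym/eqP; rewrite RRe_real // gtr0_real.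
have [|N HN] := H (complex.Re e); first by rewrite -ltcR -eE.
by exists N => // n /HN; rewrite normE -ltcR -eE.
Qed.

Lemma expr_small (t e : R) : 0 <= t -> t < 1 -> 0 < e ->
  exists N, forall n, (N <= n)%N -> t ^+ n < e.
Proof.
move=> t0 t1 e0.
have /cvgrPdist_lt/(_ _ e0) [N _ HN] : (fun n => t ^+ n) @ \oo --> (0 : R).
  by apply: cvg_expr; rewrite ger0_norm.
exists N => n /HN; rewrite sub0r normrN ger0_norm //; exact: exprn_ge0.
Qed.

Lemma bounded_upto (u : nat -> R) N : exists B, 0 <= B /\ forall n, (n < N)%N -> u n <= B.
Proof.
elim: N => [|N [B [B0 HB]]]; first by exists 0.
exists (B + `|u N|); split; first by rewrite addr_ge0.
move=> n; rewrite ltnS leq_eqVlt => /orP[/eqP ->|/HB h].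
  by have := ler_norm (u N); lra.
by have := normr_ge0 (u N); lra.
Qed.

Lemma analytic_expansion f x : analytic_at f x ->
  exists a M p, expansion f x a M p.
Proof.
case=> a [r [r0 H]].
have Hs w : m w < r -> forall e : R, 0 < e ->
    exists N, forall n, (N <= n)%N -> m (f (x + w) - psum a n w) < e.
  move=> wr; have := H (x + w); rewrite addrAC subrr add0r normE ltcR => /(_ wr).
  by move=> /cvgC HH e /HH [N HN]; exists N => n /HN; rewrite /series /= big_mkord.
pose q := r / 2.
have q0 : 0 < q by rewrite /q; lra.
have mq : m q%:C = q by rewrite m_real // ltW.
have [|N1 HN1] := Hs q%:C _ 1 ltr01; first by rewrite mq /q; lra.
have [B [B0 HB]] : exists B, 0 <= B /\ forall k, m (a k) * q ^+ k <= B.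
  have [B [B0 HB]] := bounded_upto (fun k => m (a k) * q ^+ k) N1.
  exists (B + 2); split; first lra.
  move=> k; case: (ltnP k N1) => [/HB|kN]; first lra.
  have h1 := HN1 k kN.
  have h2 := HN1 k.+1 (leqW kN).
  rewrite psumS in h2.
  have -> : m (a k) * q ^+ k = m (a k * q%:C ^+ k).
    by rewrite normcM mX mq.
  have -> : a k * q%:C ^+ k = (f (x + q%:C) - psum a k q%:C) +
      - (f (x + q%:C) - (psum a k q%:C + a k * q%:C ^+ k)) by ring.
  have := mD (f (x + q%:C) - psum a k q%:C)
     (- (f (x + q%:C) - (psum a k q%:C + a k * q%:C ^+ k))).
  rewrite mN; lra.
exists a, (2 * B), (q / 2); split; [lra|lra|].
move=> N w wq.
pose t := m w / q.
have t0 : 0 <= t by rewrite divr_ge0 ?m_ge0// ltW.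
have t1 : t <= 2^-1 by rewrite /t ler_pdivrMr //; lra.
have key : m (f (x + w) - psum a N w) <= 2 * B * t ^+ N.
  apply/ler_addgt0Pr => e e0.
  have [|N2 HN2] := Hs w _ e e0; first by rewrite /q in wq *; lra.
  have hn := HN2 (N + N2)%N (leq_addl _ _).
  have E k : psum a (N + k) w - psum a N w = \sum_(i < k) a (N + i)%N * w ^+ (N + i).
    elim: k => [|k IH]; first by rewrite addn0 big_ord0 subrr.
    by rewrite addnS psumS big_ord_recr /= -IH; ring.
  have -> : f (x + w) - psum a N w = (f (x + w) - psum a (N + N2) w) +
     (psum a (N + N2) w - psum a N w) by ring.
  apply: le_trans (mD _ _) _; rewrite [leRHS]addrC lerD //; first exact: ltW.
  rewrite E; apply: le_trans (m_sum _ (fun i => a (N + i)%N * w ^+ (N + i))) _.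
  apply: (@le_trans _ _ (\sum_(i < N2) B * t ^+ (N + i))).
    apply: ler_sum => i _; rewrite normcM mX /t expr_div_n.
    rewrite mulrC mulrCA ler_wpM2l ?exprn_ge0 ?m_ge0//.
    by rewrite ler_pdivlMr ?exprn_gt0.
  by rewrite -big_distrr /= mulrAC [leRHS]mulrC ler_wpM2l // geom_bound.
apply: le_trans key _; rewrite ler_wpM2l //; first lra.
rewrite lerXn2r ?nnegrE// ?divr_ge0 ?m_ge0//; first lra.
rewrite /t ler_wpM2l ?m_ge0// lef_pV2 ?posrE//; lra.
Qed.

Lemma expansion_analytic f x a M p : expansion f x a M p -> analytic_at f x.
Proof.
case=> M0 p0 H; exists a, p; split=> // z; rewrite normE ltcR => zp.
apply: cvgCP => e e0.
pose t := m (z - x) / p.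
have t0 : 0 <= t by rewrite divr_ge0 ?m_ge0// ltW.
have t1 : t < 1 by rewrite /t ltr_pdivrMr // mul1r.
have [|N HN] := @expr_small t (e / (M + 1)) t0 t1; first by rewrite divr_gt0 //; lra.
exists N => n /HN; rewrite ltr_pdivlMr; last lra.
have := H n _ zp; rewrite (_ : x + (z - x) = z); last ring.
rewrite /series /= big_mkord -/(psum a n _) -/t => h1 h2.
apply: le_lt_trans h1 _; have := exprn_ge0 n t0; nra.
Qed.

Lemma expansion_shrink f x a M p p' : 0 < p' -> p' <= p ->
  expansion f x a M p -> expansion f x a M p'.
Proof.
move=> p'0 pp [M0 p0 H]; split=> // N w wp.
apply: le_trans (H N w _) _; first lra.
rewrite ler_wpM2l // lerXn2r ?nnegrE ?divr_ge0 ?m_ge0// ?(ltW p0) ?(ltW p'0)//.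
by rewrite ler_wpM2l ?m_ge0// lef_pV2 ?posrE.
Qed.

Lemma expansion_cst (c : C) x : expansion (fun=> c) x (fun k => if k == 0%N then c else 0) (m c) 1.
Proof.
split; [exact: m_ge0 | exact: ltr01 |] => N w w1.
have E n : psum (fun k => if k == 0%N then c else 0) n.+1 w = c.
  elim: n => [|n IH]; first by rewrite psumS psum0 add0r expr0 mulr1.
  by rewrite psumS IH mul0r addr0.
case: N => [|N]; first by rewrite psum0 subr0 expr0 mulr1.
by rewrite E subrr normc0 mulr_ge0 ?exprn_ge0 ?divr_ge0 ?m_ge0.
Qed.

Lemma expansion_id x : expansion id x
  (fun k => if k == 0%N then x else if k == 1%N then 1 else 0) (m x + 1) 1.
Proof.
have mx := m_ge0 x.
split; [lra | exact: ltr01 |] => N w w1.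
have E n : psum (fun k => if k == 0%N then x else if k == 1%N then 1 else 0) n.+2 w = x + w.
  elim: n => [|n IH]; first by rewrite !psumS psum0 add0r expr0 mulr1 mul1r expr1.
  by rewrite psumS IH mul0r addr0.
have mw := m_ge0 w.
case: N => [|[|N]].
- by rewrite psum0 subr0 expr0 mulr1; have := mD x w; lra.
- rewrite psumS psum0 add0r expr0 mulr1 expr1 divr1 addrAC subrr add0r; nra.
- by rewrite E subrr normc0 mulr_ge0 ?exprn_ge0 ?divr_ge0 ?m_ge0//; lra.
Qed.

Lemma psumD a b N w : psum (fun k => a k + b k) N w = psum a N w + psum b N w.
Proof. by rewrite /psum -big_split; apply: eq_bigr => i _; rewrite mulrDl. Qed.

Lemma common f g x : analytic_at f x -> analytic_at g x ->
  exists a M b M' p, expansion f x a M p /\ expansion g x b M' p.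
Proof.
move=> /analytic_expansion [a [M [p Hf]]] /analytic_expansion [b [M' [q Hg]]].
have [_ p0 _] := Hf; have [_ q0 _] := Hg.
exists a, M, b, M', (Num.min p q); split.
  by apply: expansion_shrink Hf; rewrite ?lt_min ?p0 ?q0 ?ge_min ?lexx.
by apply: expansion_shrink Hg; rewrite ?lt_min ?p0 ?q0 ?ge_min ?lexx ?orbT.
Qed.

Lemma analytic_cst (c : C) x : analytic_at (fun=> c) x.
Proof. exact: expansion_analytic (expansion_cst c x). Qed.

Lemma analytic_id x : analytic_at id x.
Proof. exact: expansion_analytic (expansion_id x). Qed.

Lemma analyticD f g x : analytic_at f x -> analytic_at g x ->
  analytic_at (fun z => f z + g z) x.
Proof.
move=> fx gx; have [a [M [b [M' [p [[M0 p0 Hf] [M'0 _ Hg]]]]]]] := common fx gx.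
apply: (@expansion_analytic _ _ (fun k => a k + b k) (M + M') p); split=> //; first lra.
move=> N w wp; rewrite psumD.
have -> : f (x + w) + g (x + w) - (psum a N w + psum b N w) =
  (f (x + w) - psum a N w) + (g (x + w) - psum b N w) by ring.
by apply: le_trans (mD _ _) _; rewrite mulrDl lerD // ?Hf ?Hg.
Qed.

Definition conv a b k : C := \sum_(i < k.+1) a i * b (k - i)%N.

Lemma psum_conv a b N w :
  psum (conv a b) N w = \sum_(i < N) a i * w ^+ i * psum b (N - i) w.
Proof.
elim: N => [|N IH]; first by rewrite psum0 big_ord0.
rewrite psumS IH [RHS]big_ord_recr /= subSn // subnn psumS psum0 add0r expr0 mulr1.
have -> : \sum_(i < N) a i * w ^+ i * psum b (N.+1 - i) w =
   \sum_(i < N) a i * w ^+ i * psum b (N - i) w + \sum_(i < N) a i * b (N - i)%N * w ^+ N.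
  rewrite -big_split /=; apply: eq_bigr => i _.
  rewrite subSn ?(ltnW (ltn_ord i)) // psumS mulrDr; congr (_ + _).
  have -> : w ^+ N = w ^+ i * w ^+ (N - i).
    by rewrite -exprD subnKC // ltnW.
  ring.
rewrite -big_distrl /= /conv big_ord_recr /= subnn; ring.
Qed.

Lemma expansion_coef f x a M p k w : expansion f x a M p -> m w < p ->
  m (a k * w ^+ k) <= 2 * M * (m w / p) ^+ k.
Proof.
case=> M0 p0 H wp.
have h1 := H k w wp; have h2 := H k.+1 w wp.
have t0 : 0 <= m w / p by rewrite divr_ge0 ?m_ge0 // ltW.
have t1 : m w / p <= 1 by rewrite ler_pdivrMr // mul1r ltW.
have -> : a k * w ^+ k = (f (x + w) - psum a k w) + - (f (x + w) - psum a k.+1 w).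
  by rewrite psumS; ring.
apply: le_trans (mD _ _) _; rewrite mN.
have := exprn_ge0 k t0; rewrite exprS in h2.
set T := (m w / p) ^+ k in h1 h2 *; set t := m w / p in h2 t0 t1 *.
move=> T0; have : t * T <= T by nra.
have : 0 <= t * T by nra.
nra.
Qed.

Lemma expansion_coef_bound f x a M p k : expansion f x a M p ->
  m (a k) <= 2 * M * (2 / p) ^+ k.
Proof.
move=> Hf; have [M0 p0 _] := Hf.
have mp : m (p / 2)%:C = p / 2 by rewrite m_real // ; lra.
have := @expansion_coef _ _ _ _ _ k (p / 2)%:C Hf.
rewrite normcM mX mp => /(_ ltac:(lra)).
have -> : p / 2 / p = 2^-1 by field; rewrite gt_eqF.
move=> h.
have p2 : 0 < (p / 2) ^+ k by rewrite exprn_gt0 //; lra.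
rewrite -(ler_pM2r p2).
have -> : 2 * M * (2 / p) ^+ k * (p / 2) ^+ k = 2 * M * 1.
  rewrite -mulrA; congr (_ * _); rewrite -exprMn.
  have -> : 2 / p * (p / 2) = 1 by field; rewrite gt_eqF.
  by rewrite expr1n.
apply: le_trans h _; rewrite ler_wpM2l //; first lra.
by rewrite exprn_ile1 //; lra.
Qed.

Lemma nat_le_pow2 (N : nat) : N.+1%:R <= (2 : R) ^+ N.
Proof. by rewrite -natrX ler_nat ltn_expl. Qed.

Lemma analyticM f g x : analytic_at f x -> analytic_at g x ->
  analytic_at (fun z => f z * g z) x.
Proof.
move=> fx gx; have [a [M [b [M' [p [Hf Hg]]]]]] := common fx gx.
have [M0 p0 Hf'] := Hf; have [M'0 _ Hg'] := Hg.
apply: (@expansion_analytic _ _ (conv a b) (2 * M * M') (p / 2)).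
split; [nra | lra |] => N w wp.
have {}wp : m w < p by lra.
rewrite psum_conv.
pose t := m w / p.
have t0 : 0 <= t by rewrite divr_ge0 ?m_ge0 // ltW.
have -> : f (x + w) * g (x + w) - \sum_(i < N) a i * w ^+ i * psum b (N - i) w =
   (f (x + w) - psum a N w) * g (x + w) +
   \sum_(i < N) a i * w ^+ i * (g (x + w) - psum b (N - i) w).
  have -> : \sum_(i < N) a i * w ^+ i * (g (x + w) - psum b (N - i) w) =
    psum a N w * g (x + w) - \sum_(i < N) a i * w ^+ i * psum b (N - i) w.
    rewrite /psum big_distrl /= -sumrB; apply: eq_bigr => i _; ring.
  ring.
have h1 : m ((f (x + w) - psum a N w) * g (x + w)) <= M * M' * t ^+ N.
  rewrite normcM mulrAC ler_pM ?m_ge0 //; first exact: Hf'.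
  by have := Hg' 0%N w wp; rewrite psum0 subr0 expr0 mulr1.
have h2 : m (\sum_(i < N) a i * w ^+ i * (g (x + w) - psum b (N - i) w))
    <= N%:R * (2 * M * M' * t ^+ N).
  apply: le_trans (m_sum _ (fun i => a i * w ^+ i * (g (x + w) - psum b (N - i) w))) _.
  have -> : N%:R * (2 * M * M' * t ^+ N) = \sum_(i < N) 2 * M * M' * t ^+ N.
    by rewrite sumr_const card_ord mulr_natl.
  apply: ler_sum => i _.
  have -> : t ^+ N = t ^+ i * t ^+ (N - i).
    by rewrite -exprD subnKC // ltnW.
  rewrite normcM.
  have -> : 2 * M * M' * (t ^+ i * t ^+ (N - i)) = (2 * M * t ^+ i) * (M' * t ^+ (N - i)) by ring.
  rewrite ler_pM ?m_ge0 //; first exact: expansion_coef Hf wp.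
  exact: Hg'.
apply: le_trans (mD _ _) _.
have -> : m w / (p / 2) = 2 * t by rewrite /t; field; rewrite gt_eqF.
rewrite exprMn.
have := nat_le_pow2 N; rewrite -natr1.
have T0 := exprn_ge0 N t0.
set T := t ^+ N in h1 h2 T0 *; set E := (2:R) ^+ N; set n := (N%:R : R) in h2 *.
move=> hE.
have K0 : 0 <= M * M' * T by rewrite !mulr_ge0.
have : (n + 1) * (M * M' * T) <= E * (M * M' * T) by rewrite ler_wpM2r.
nra.
Qed.

End Analytic.

Section AnalyticInverse.
Variable R : realType.
Local Notation C := R[i].
Local Notation m := (@normc R).
Implicit Types (f g : C -> C) (a b : nat -> C) (x z w : C).

Fixpoint invs a n : seq C :=
  if n is n'.+1 then
    rcons (invs a n')
      (((n' == 0%N)%:R - \sum_(i < n') (invs a n')`_i * a (n' - i)%N) / a 0%N)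
  else [::].

Definition invc a n := (invs a n.+1)`_n.

Lemma size_invs a n : size (invs a n) = n.
Proof. by elim: n => //= n IH; rewrite size_rcons IH. Qed.

Lemma nth_invs a n k : (k < n)%N -> (invs a n)`_k = invc a k.
Proof.
elim: n => // n IH; rewrite ltnS leq_eqVlt => /orP[/eqP ->//|kn].
by rewrite -(IH kn) /= nth_rcons size_invs kn.
Qed.

Lemma invcE a n :
  invc a n = ((n == 0%N)%:R - \sum_(i < n) invc a i * a (n - i)%N) / a 0%N.
Proof.
rewrite {1}/invc /= nth_rcons size_invs ltnn eqxx.
by congr ((_ - _) / _); apply: eq_bigr => i _; rewrite nth_invs.
Qed.

Lemma conv_invc a n : a 0%N != 0 -> conv (invc a) a n = (n == 0%N)%:R.
Proof.
move=> a0; rewrite /conv big_ord_recr /= subnn [in X in _ + X]invcE divfK //.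
by rewrite addrC subrK.
Qed.

Lemma mV z : m z^-1 = (m z)^-1. Proof. exact: normcV. Qed.

Lemma expansion0 f x a M p : expansion f x a M p -> f x = a 0%N.
Proof.
case=> M0 p0 H; have := H 1%N 0; rewrite normc0 => /(_ p0).
rewrite mul0r expr1 mulr0 psumS psum0 expr0 mulr1 add0r addr0 => h.
by apply/eqP; rewrite -subr_eq0 -m_eq0 eq_le h m_ge0.
Qed.

Lemma invc_bound a (A q : R) : 0 <= A -> 0 <= q -> a 0%N != 0 ->
  (forall k, m (a k) <= A * q ^+ k) ->
  forall n, m (invc a n) <= (m (a 0%N))^-1 * ((1 + A * (m (a 0%N))^-1) * q) ^+ n.
Proof.
move=> A0 q0 a0 Ha n.
set B := (m (a 0%N))^-1; set K := 1 + A * B.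
have B0 : 0 <= B by rewrite invr_ge0 m_ge0.
have K1 : 1 <= K by rewrite /K; nra.
elim/ltn_ind: n => -[|n] IH.
  by rewrite invcE big_ord0 subr0 mul1r expr0 mulr1 mV.
rewrite invcE sub0r normcM mN mV -/B mulrC ler_wpM2l //.
apply: le_trans (m_sum _ (fun i => invc a i * a (n.+1 - i)%N)) _.
apply: (@le_trans _ _ (\sum_(i < n.+1) (A * B * q ^+ n.+1) * K ^+ i)).
  apply: ler_sum => i _.
  have -> : q ^+ n.+1 = q ^+ i * q ^+ (n.+1 - i) by rewrite -exprD subnKC // ltnW.
  have -> : A * B * (q ^+ i * q ^+ (n.+1 - i)) * K ^+ i =
    (B * (K * q) ^+ i) * (A * q ^+ (n.+1 - i)) by rewrite exprMn; ring.
  by rewrite normcM ler_pM ?m_ge0 ?IH.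
rewrite -big_distrr /= mulrAC exprMn ler_wpM2r ?exprn_ge0 //.
have := subrX1 K n.+1; have -> : K - 1 = A * B by rewrite /K; ring.
by move=> <-; rewrite lerBlDr lerDl.
Qed.

Lemma analyticV f x : analytic_at f x -> f x != 0 ->
  analytic_at (fun z => (f z)^-1) x.
Proof.
move=> /analytic_expansion [a [M [p Hf]]] fx0.
have [M0 p0 H] := Hf.
have fa : f x = a 0%N := expansion0 Hf.
have a0 : a 0%N != 0 by rewrite -fa.
have ma0 : 0 < m (a 0%N) by rewrite lt0r m_eq0 a0 m_ge0.
pose B := (m (a 0%N))^-1.
have B0 : 0 < B by rewrite invr_gt0.
have Hb := @invc_bound a (2 * M) (2 / p) _ _ a0 (fun k => expansion_coef_bound k Hf).
pose L := (1 + 2 * M * B) * (2 / p).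
have ip0 : 0 < p^-1 by rewrite invr_gt0.
have Lp : p^-1 <= L by rewrite /L; have : 0 <= 2 * M * B; nra.
have L0 : 0 < L by lra.
pose p' := Num.min (Num.min p (2 * L)^-1) (p * (m (a 0%N) / (2 * (M + 1)))).
have p'0 : 0 < p'.
  have q1 : 0 < (2 * L)^-1 by rewrite invr_gt0; lra.
  have q2 : 0 < m (a 0%N) / (2 * (M + 1)) by rewrite divr_gt0 //; lra.
  by rewrite /p' !lt_min p0 q1 mulr_gt0.
apply: (@expansion_analytic _ _ _ (invc a) (2 * B * (B * M) + 2 * B) p').
split=> //; first by nra.
move=> N w; rewrite {1}/p' !lt_min => /andP[/andP[wp w2] w3].
set t := m w in wp w2 w3 *.
have t0 : 0 <= t := m_ge0 w.
have fw : m (f (x + w))^-1 <= 2 * B.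
  have := H 1%N w wp; rewrite psumS psum0 add0r expr0 mulr1 expr1 -/t => h.
  have h2 : M * (t / p) <= m (a 0%N) / 2.
    rewrite (_ : m (a 0%N) / 2 = (M + 1) * (m (a 0%N) / (2 * (M + 1)))); last first.
      by field; rewrite gt_eqF //; lra.
    rewrite ler_pM //; [by rewrite divr_ge0 // ltW | lra |].
    by rewrite ler_pdivrMr // mulrC ltW.
  have h3 : m (a 0%N) <= m (f (x + w)) + m (f (x + w) - a 0%N).
    rewrite -(mN (f (x + w) - _)); apply: le_trans (mD _ _).
    by rewrite opprB addrC subrK.
  have h4 : m (a 0%N) / 2 <= m (f (x + w)) by lra.
  rewrite mV /B -[2]invrK -invfM lef_pV2 ?posrE; first lra.
  - lra.
  - lra.
have fw0 : f (x + w) != 0.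
  apply/eqP => e; have := H 1%N w wp.
  rewrite psumS psum0 add0r expr0 mulr1 expr1 -/t e sub0r mN => h.
  have h2 : M * (t / p) <= m (a 0%N) / 2.
    rewrite (_ : m (a 0%N) / 2 = (M + 1) * (m (a 0%N) / (2 * (M + 1)))); last first.
      by field; rewrite gt_eqF //; lra.
    rewrite ler_pM //; [by rewrite divr_ge0 // ltW | lra |].
    by rewrite ler_pdivrMr // mulrC ltW.
  lra.
case: N => [|N].
  rewrite psum0 subr0 expr0 mulr1; apply: le_trans fw _; nra.
have E : 1 - f (x + w) * psum (invc a) N.+1 w =
   - \sum_(j < N.+1) invc a j * w ^+ j * (f (x + w) - psum a (N.+1 - j) w).
  have -> : \sum_(j < N.+1) invc a j * w ^+ j * (f (x + w) - psum a (N.+1 - j) w) =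
     f (x + w) * psum (invc a) N.+1 w - psum (conv (invc a) a) N.+1 w.
    rewrite psum_conv /psum big_distrr /= -sumrB; apply: eq_bigr => i _; ring.
  have -> : psum (conv (invc a) a) N.+1 w = 1.
    rewrite /psum big_ord_recl conv_invc // expr0 mulr1 big1 ?addr0 // => i _.
    by rewrite conv_invc // mul0r.
  ring.
have h1 : m (1 - f (x + w) * psum (invc a) N.+1 w) <= N.+1%:R * (B * M * (L * t) ^+ N.+1).
  rewrite E mN.
  apply: le_trans (m_sum _ (fun j => invc a j * w ^+ j * (f (x + w) - psum a (N.+1 - j) w))) _.
  have -> : N.+1%:R * (B * M * (L * t) ^+ N.+1) = \sum_(i < N.+1) B * M * (L * t) ^+ N.+1.
    by rewrite sumr_const card_ord mulr_natl.
  apply: ler_sum => i _.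
  have -> : (L * t) ^+ N.+1 = (L * t) ^+ i * (L * t) ^+ (N.+1 - i).
    by rewrite -exprD subnKC // ltnW.
  have -> : B * M * ((L * t) ^+ i * (L * t) ^+ (N.+1 - i)) =
    (B * L ^+ i * t ^+ i) * (M * (L * t) ^+ (N.+1 - i)) by rewrite exprMn; ring.
  rewrite normcM ler_pM ?m_ge0 //.
    rewrite normcM mX ler_wpM2r ?exprn_ge0 //; apply: Hb; first lra.
    by rewrite divr_ge0 // ltW.
  apply: le_trans (H _ _ wp) _; rewrite ler_wpM2l // lerXn2r ?nnegrE //.
  - by rewrite divr_ge0 // ltW.
  - by rewrite mulr_ge0 // ltW.
  - by rewrite mulrC ler_wpM2r.
have -> : (f (x + w))^-1 - psum (invc a) N.+1 w =
   (f (x + w))^-1 * (1 - f (x + w) * psum (invc a) N.+1 w) by field.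
rewrite normcM.
have h2 : N.+1%:R * (B * M * (L * t) ^+ N.+1) <= B * M * (t / p') ^+ N.+1.
  have -> : N.+1%:R * (B * M * (L * t) ^+ N.+1) = B * M * (N.+1%:R * (L * t) ^+ N.+1) by ring.
  rewrite ler_wpM2l ?mulr_ge0 //; first lra.
  apply: (@le_trans _ _ ((2 * L * t) ^+ N.+1)).
    have Lt0 : 0 <= L * t by rewrite mulr_ge0 // ltW.
    rewrite -mulrA [leRHS]exprMn ler_wpM2r ?exprn_ge0 //.
    apply: le_trans (nat_le_pow2 R N) _; rewrite exprS.
    have := exprn_ge0 N (ler0n R 2); lra.
  have L20 : 0 <= 2 * L * t by rewrite mulr_ge0 //; lra.
  have tp' : 0 <= t / p' by rewrite divr_ge0 // ltW.
  rewrite lerXn2r ?nnegrE //.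
  rewrite mulrC ler_wpM2l // -[2 * L]invrK lef_pV2 ?posrE //; last first.
    by rewrite invr_gt0; lra.
  by rewrite /p' !ge_min lexx orbT.
have T0 : 0 <= (t / p') ^+ N.+1 by rewrite exprn_ge0 // divr_ge0 // ltW.
apply: (@le_trans _ _ ((2 * B) * (B * M * (t / p') ^+ N.+1))).
  rewrite ler_pM ?m_ge0 //; exact: le_trans h1 h2.
set T := (t / p') ^+ N.+1 in T0 *; nra.
Qed.

Lemma expansion_eq f g x a M p r : 0 < r ->
  (forall z, m (z - x) < r -> f z = g z) -> expansion f x a M p ->
  expansion g x a M (Num.min p r).
Proof.
move=> r0 fg Hf; have [M0 p0 _] := Hf.
have [] : expansion f x a M (Num.min p r).
  by apply: expansion_shrink Hf; rewrite ?lt_min ?p0 ?r0 ?ge_min ?lexx.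
move=> _ q0 H; split=> // N w wq; rewrite -fg; first exact: H.
by rewrite addrAC subrr add0r; move: wq; rewrite lt_min => /andP[].
Qed.

Lemma analytic_near f g x : (\forall z \near x, f z = g z) ->
  analytic_at f x -> analytic_at g x.
Proof.
move=> /nbhsP [r r0 fg] /analytic_expansion [a [M [p Hf]]].
exact: expansion_analytic (expansion_eq r0 fg Hf).
Qed.

Lemma psum_shift a k N w : (forall j, (j < k)%N -> a j = 0) ->
  psum a (N + k) w = w ^+ k * psum (fun j => a (j + k)%N) N w.
Proof.
move=> H; elim: N => [|N IH].
  rewrite add0n psum0 mulr0 /psum big1 // => i _; by rewrite H // mul0r.
by rewrite addSn !psumS IH exprD; ring.
Qed.

Lemma analytic_shift f x a M p k : expansion f x a M p ->
  (forall j, (j < k)%N -> a j = 0) ->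
  analytic_at (fun z => if z == x then a k else f z / (z - x) ^+ k) x.
Proof.
move=> Hf ak; have [M0 p0 H] := Hf.
apply: (@expansion_analytic _ _ _ (fun j => a (j + k)%N) (M / p ^+ k + m (a k)) p).
have mk := m_ge0 (a k).
have Mk : 0 <= M / p ^+ k by rewrite divr_ge0 ?exprn_ge0 // ltW.
split=> //; first lra.
move=> N w wp; rewrite -subr_eq0 addrAC subrr add0r.
have t0 : 0 <= m w / p by rewrite divr_ge0 ?m_ge0 // ltW.
have [->|w0] := eqVneq w 0.
  case: N => [|N]; first by rewrite psum0 subr0 expr0 mulr1; lra.
  have -> : psum (fun j => a (j + k)%N) N.+1 0 = a k.
    rewrite /psum big_ord_recl big1 ?addr0 ?expr0 ?mulr1 // => i _.
    by rewrite expr0n mulr0.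
  by rewrite subrr !normc0 mul0r expr0n /= mulr0.
have wk : w ^+ k != 0 by rewrite expf_neq0.
have mwk : 0 < m w ^+ k by rewrite exprn_gt0 // lt0r m_eq0 w0 m_ge0.
have -> : f (x + w) / w ^+ k - psum (fun j => a (j + k)%N) N w =
   (f (x + w) - psum a (N + k) w) * (w ^+ k)^-1.
  by rewrite psum_shift //; field.
rewrite normcM mV mX ler_pdivrMr //.
apply: le_trans (H _ _ wp) _; rewrite exprD.
have -> : M * ((m w / p) ^+ N * (m w / p) ^+ k) = M / p ^+ k * ((m w / p) ^+ N * m w ^+ k).
  by rewrite [(m w / p) ^+ k]expr_div_n; ring.
rewrite -[leRHS]mulrA ler_wpM2r //; last lra.
by rewrite mulr_ge0 ?exprn_ge0 // m_ge0.
Qed.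

Lemma expansion_zero f x a M p : expansion f x a M p -> (forall k, a k = 0) ->
  \forall z \near x, f z = 0.
Proof.
case=> M0 p0 H a0; apply/nbhsP; exists p => // z zp.
apply/eqP; rewrite -m_eq0 eq_le m_ge0 andbT; apply/ler_addgt0Pr => e e0.
pose t := m (z - x) / p.
have t0 : 0 <= t by rewrite divr_ge0 ?m_ge0// ltW.
have t1 : t < 1 by rewrite /t ltr_pdivrMr // mul1r.
have [|N /(_ N (leqnn N)) HN] := @expr_small _ t (e / (M + 1)) t0 t1.
  by rewrite divr_gt0 //; lra.
have := H N _ zp; rewrite -/t (_ : x + (z - x) = z); last ring.
have -> : psum a N (z - x) = 0 by rewrite /psum big1 // => i _; rewrite a0 mul0r.
rewrite subr0 add0r => h; apply: le_trans h _.
move: HN; rewrite ltr_pdivlMr; last lra.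
have := exprn_ge0 N t0; nra.
Qed.

Lemma analytic_continuous f x : analytic_at f x ->
  forall e : R, 0 < e -> \forall z \near x, m (f z - f x) < e.
Proof.
move=> /analytic_expansion [a [M [p Hf]]] e e0; have [M0 p0 H] := Hf.
apply/nbhsP; exists (Num.min p (p * (e / (M + 1)))).
  by rewrite lt_min p0 mulr_gt0 // divr_gt0 //; lra.
move=> z; rewrite lt_min => /andP[zp ze].
have := H 1%N _ zp; rewrite psumS psum0 add0r expr0 mulr1 expr1 -(expansion0 Hf).
rewrite (_ : x + (z - x) = z); last ring.
move=> h; apply: le_lt_trans h _.
set t := m (z - x) / p.
have t0 : 0 <= t by rewrite divr_ge0 ?m_ge0 // ltW.
have : t < e / (M + 1) by rewrite /t ltr_pdivrMr // mulrC.
rewrite ltr_pdivlMr; last lra.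
nra.
Qed.

Lemma analytic_neq0 f x : analytic_at f x -> f x != 0 -> \forall z \near x, f z != 0.
Proof.
move=> fx fx0.
have e0 : 0 < m (f x) by rewrite lt0r m_eq0 fx0 m_ge0.
near=> z.
have : m (f z - f x) < m (f x) by near: z; exact: analytic_continuous.
by apply: contraTneq => ->; rewrite sub0r mN ltxx.
Unshelve. all: by end_near. Qed.

Lemma analytic_eq_dnbhs f g x : analytic_at f x -> analytic_at g x ->
  (\forall z \near x^', f z = g z) -> f x = g x.
Proof.
move=> fx gx fg; apply/eqP; rewrite -subr_eq0; apply/negPn/negP => n0.
have ngx : analytic_at (fun z => f z - g z) x.
  apply: (@analytic_near (fun z => f z + (-1) * g z)).
    by near=> z; rewrite mulN1r.
  exact: (analyticD fx (analyticM (analytic_cst (-1) x) gx)).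
have /nbhsP [r r0 H1] := analytic_neq0 ngx n0.
have /dnbhsP [s s0 H2] := fg.
pose e := Num.min r s / 2.
have e0 : 0 < e by rewrite /e divr_gt0 // lt_min r0 s0.
have eE : x + e%:C - x = e%:C by ring.
have me : m e%:C = e by rewrite m_real // ltW.
have hr : e < r /\ e < s.
  have : Num.min r s <= r by rewrite ge_min lexx.
  have : Num.min r s <= s by rewrite ge_min lexx orbT.
  by move: e0; rewrite /e; split; lra.
have := H1 (x + e%:C); rewrite eE me => /(_ hr.1).
rewrite H2 ?subrr ?eqxx //; last by rewrite eE me; case: hr.
by rewrite -subr_eq0 eE -m_eq0 me gt_eqF.
Unshelve. all: by end_near. Qed.

End AnalyticInverse.

Section Holomorphic.
Variable R : realType.
Local Notation C := R[i].
Local Notation m := (@normc R).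
Implicit Types (f g h : C -> C) (x y z : C).

Lemma near_nbhs x (P : set C) : (\forall z \near x, P z) ->
  \forall y \near x, \forall z \near y, P z.
Proof. by move=> H; exact: (@near_join C x P H). Qed.

Lemma near_dnbhs x (P : set C) : (\forall z \near x^', P z) ->
  \forall y \near x^', \forall z \near y, P z.
Proof.
move=> /dnbhsP [r r0 H]; apply/dnbhsP; exists r => // y yx yr.
have d0 : 0 < m (y - x) by rewrite lt0r m_eq0 subr_eq0 yx m_ge0.
apply/nbhsP; exists (Num.min (m (y - x)) (r - m (y - x))).
  by rewrite lt_min d0 subr_gt0.
move=> z; rewrite lt_min => /andP[z1 z2].
apply: H.
  by apply: contraTneq z1 => ->; rewrite -mN opprB ltxx.
have -> : z - x = (z - y) + (y - x) by ring.
by apply: le_lt_trans (mD _ _) _; lra.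
Qed.

Lemma dnbhs_neq x : \forall z \near x^', z != x.
Proof. by apply/dnbhsP; exists 1. Qed.

Lemma dnbhs_ex x (P : set C) : (\forall z \near x^', P z) -> exists z, P z.
Proof.
move=> /dnbhsP [r r0 H]; exists (x + (r / 2)%:C).
have E : x + (r / 2)%:C - x = (r / 2)%:C by ring.
have me : m (r / 2)%:C = r / 2 by rewrite m_real //; lra.
apply: H; last by rewrite E me; lra.
by rewrite -subr_eq0 E -m_eq0 me gt_eqF //; lra.
Qed.

Lemma nbhs_split x (P : set C) : (\forall z \near x^', P z) -> P x ->
  \forall z \near x, P z.
Proof.
move=> /dnbhsP [r r0 H] Px; apply/nbhsP; exists r => // z zr.
by have [->//|zx] := eqVneq z x; exact: H.
Qed.

Lemma nbhs_weak x (P : set C) : (\forall z \near x, P z) -> \forall z \near x^', P z.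
Proof. by move=> /nbhsP [r r0 H]; apply/dnbhsP; exists r => // z _ /H. Qed.

Lemma holo_analytic f x : holomorphic_at f x -> analytic_at f x.
Proof. exact: nbhs_singleton. Qed.

Lemma holo_near f g x : (\forall z \near x, f z = g z) ->
  holomorphic_at f x -> holomorphic_at g x.
Proof.
move=> /near_nbhs fg; rewrite /holomorphic_at => fx.
by apply: filterS2 fg fx => y; exact: analytic_near.
Qed.

Lemma holo_cst (c : C) x : holomorphic_at (fun=> c) x.
Proof. by apply: filterE => y; exact: analytic_cst. Qed.

Lemma holo_id x : holomorphic_at id x.
Proof. by apply: filterE => y; exact: analytic_id. Qed.

Lemma holoD f g x : holomorphic_at f x -> holomorphic_at g x ->
  holomorphic_at (fun z => f z + g z) x.
Proof. by apply: filterS2 => y; exact: analyticD. Qed.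

Lemma holoM f g x : holomorphic_at f x -> holomorphic_at g x ->
  holomorphic_at (fun z => f z * g z) x.
Proof. by apply: filterS2 => y; exact: analyticM. Qed.

Lemma holoV f x : holomorphic_at f x -> f x != 0 ->
  holomorphic_at (fun z => (f z)^-1) x.
Proof.
move=> fx fx0; have n0 := analytic_neq0 (holo_analytic fx) fx0.
by apply: filterS2 fx n0 => y; exact: analyticV.
Qed.

Lemma holoX (c : C) n x : holomorphic_at (fun z => (z - c) ^+ n) x.
Proof.
elim: n => [|n IH].
  apply: (@holo_near (fun=> 1)); last exact: holo_cst.
  by apply: filterE => z; rewrite expr0.
apply: (@holo_near (fun z => (z + - c) * (z - c) ^+ n)).
  by apply: filterE => z; rewrite exprS.
exact: (holoM (holoD (holo_id x) (holo_cst (- c) x)) IH).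
Qed.

Lemma holo_factor g x : holomorphic_at g x ->
  (\forall z \near x, g z = 0) \/
  exists k h, [/\ holomorphic_at h x, h x != 0 &
    \forall z \near x, g z = (z - x) ^+ k * h z].
Proof.
move=> gx; have [a [M [p Hg]]] := analytic_expansion (holo_analytic gx).
have [|na] := pselect (exists k, a k != 0); last first.
  left; apply: expansion_zero Hg _ => k.
  by apply/eqP/negPn/negP => ak; apply: na; exists k.
move=> exa; case: (ex_minnP exa) => k ak kmin; right.
have a0 j : (j < k)%N -> a j = 0.
  by move=> jk; apply/eqP/negPn/negP => /kmin; rewrite leqNgt jk.
pose h z := if z == x then a k else g z / (z - x) ^+ k.
have ax := analytic_shift Hg a0.
exists k, h; split; last 2 first.
- by rewrite /h eqxx.
- apply: nbhs_split.
    apply: filterS (dnbhs_neq x) => z zx.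
    rewrite /h (negbTE zx) mulrC divfK // expf_neq0 // subr_eq0 //.
  rewrite /h eqxx subrr expr0n; case: (posnP k) => [k0|k0].
    by rewrite (expansion0 Hg) k0 mul1r.
  by rewrite mul0r (expansion0 Hg) a0.
apply: nbhs_split => //.
apply: filterS2 (nbhs_weak gx) (dnbhs_neq x) => y gy yx.
have e0 : (y - x) ^+ k != 0 by rewrite expf_neq0 // subr_eq0.
apply: (@analytic_near _ (fun z => g z * ((z - x) ^+ k)^-1)).
  have : \forall z \near y, z != x.
    apply/nbhsP; exists (m (y - x)).
      by rewrite lt0r m_eq0 subr_eq0 yx m_ge0.
    by move=> z; apply: contraTneq => ->; rewrite -mN opprB ltxx.
  by apply: filterS => z zx; rewrite /h (negbTE zx).
exact: (analyticM gy (analyticV (holo_analytic (holoX x k y)) e0)).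
Qed.

Definition mero_at f x := exists n g, holomorphic_at g x /\
  \forall z \near x^', f z = g z / (z - x) ^+ n.

Lemma mero_factor f x : mero_at f x ->
  (\forall z \near x^', f z = 0) \/
  exists k n h, [/\ holomorphic_at h x, h x != 0 &
    \forall z \near x^', f z = (z - x) ^+ k * h z / (z - x) ^+ n].
Proof.
move=> [n [g [gx fg]]]; case: (holo_factor gx) => [g0|[k [h [hx h0 gh]]]].
  left; apply: filterS2 fg (nbhs_weak g0) => z -> ->.
  by rewrite mul0r.
right; exists k, n, h; split=> //.
by apply: filterS2 fg (nbhs_weak gh) => z -> ->.
Qed.

Lemma holo_mero f x : holomorphic_at f x -> mero_at f x.
Proof.
by move=> fx; exists 0%N, f; split=> //; apply: filterE => z; rewrite expr0 divr1.
Qed.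

Lemma pole_mero f x : pole_at f x -> mero_at f x.
Proof. by move=> [n [g [gx _ fg]]]; exists n.+1, g. Qed.

Lemma meroD f g x : mero_at f x -> mero_at g x -> mero_at (fun z => f z + g z) x.
Proof.
move=> [n [f1 [f1x ff1]]] [k [g1 [g1x gg1]]].
exists (n + k)%N, (fun z => f1 z * (z - x) ^+ k + g1 z * (z - x) ^+ n); split.
  exact: (holoD (holoM f1x (holoX x k x)) (holoM g1x (holoX x n x))).
apply: filterS3 ff1 gg1 (dnbhs_neq x) => z -> ->.
rewrite -subr_eq0 => zx; rewrite exprD.
have e1 : (z - x) ^+ n != 0 by rewrite expf_neq0.
have e2 : (z - x) ^+ k != 0 by rewrite expf_neq0.
by field; rewrite e1 e2.
Qed.

Lemma meroM f g x : mero_at f x -> mero_at g x -> mero_at (fun z => f z * g z) x.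
Proof.
move=> [n [f1 [f1x ff1]]] [k [g1 [g1x gg1]]].
exists (n + k)%N, (fun z => f1 z * g1 z); split; first exact: holoM.
apply: filterS3 ff1 gg1 (dnbhs_neq x) => z -> ->.
rewrite -subr_eq0 => zx; rewrite exprD.
have e1 : (z - x) ^+ n != 0 by rewrite expf_neq0.
have e2 : (z - x) ^+ k != 0 by rewrite expf_neq0.
by field; rewrite e1 e2.
Qed.

Lemma meroV f x : mero_at f x -> mero_at (fun z => (f z)^-1) x.
Proof.
move=> /mero_factor [f0|[k [n [h [hx h0 fh]]]]].
  exists 0%N, (fun=> 0); split; first exact: holo_cst.
  by apply: filterS f0 => z ->; rewrite invr0 mul0r.
exists k, (fun z => (z - x) ^+ n * (h z)^-1); split.
  exact: (holoM (holoX x n x) (holoV hx h0)).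
apply: filterS fh => z ->; rewrite !invfM invrK; ring.
Qed.

Lemma mero_holo f x : mero_at f x -> \forall y \near x^', holomorphic_at f y.
Proof.
move=> [n [g [gx /near_dnbhs fg]]].
apply: filterS3 (nbhs_weak (near_nbhs gx)) fg (dnbhs_neq x) => y gy fgy.
rewrite -subr_eq0 => yx.
apply: (@holo_near (fun z => g z * ((z - x) ^+ n)^-1)).
  by apply: filterS fgy => z ->.
by apply: (holoM gy); apply: (holoV (holoX x n y)); rewrite expf_neq0.
Qed.

Lemma mero_holo_or_pole f x : mero_at f x ->
  (exists g, holomorphic_at g x /\ \forall z \near x^', f z = g z) \/ pole_at f x.
Proof.
move=> /mero_factor [f0|[k [n [h [hx h0 fh]]]]].
  by left; exists (fun=> 0); split=> //; exact: holo_cst.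
case: (leqP n k) => nk.
  left; exists (fun z => (z - x) ^+ (k - n) * h z); split.
    exact: (holoM (holoX x (k - n) x) hx).
  apply: filterS2 fh (dnbhs_neq x) => z ->; rewrite -subr_eq0 => zx.
  have e1 : (z - x) ^+ n != 0 by rewrite expf_neq0.
  rewrite -{1}(subnK nk) exprD; by field.
right; exists (n - k).-1, h; split=> //.
apply: filterS2 fh (dnbhs_neq x) => z ->; rewrite -subr_eq0 => zx.
rewrite prednK ?subn_gt0 // -{1}(subnK (ltnW nk)) exprD.
have e1 : (z - x) ^+ k != 0 by rewrite expf_neq0.
have e2 : (z - x) ^+ (n - k) != 0 by rewrite expf_neq0.
by field; rewrite e1 e2.
Qed.

Lemma holo_pole f g x : holomorphic_at f x -> pole_at g x ->
  (\forall z \near x^', f z = g z) -> False.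
Proof.
move=> fx [n [h [hx h0 gh]]] fg; case/negP: h0; apply/eqP.
have := holoM (holoX x n.+1 x) fx => /holo_analytic /analytic_eq_dnbhs E.
rewrite -(E h); first by rewrite subrr exprS !mul0r.
- exact: holo_analytic.
- apply: filterS3 fg gh (dnbhs_neq x) => z -> ->; rewrite -subr_eq0 => zx.
  by rewrite mulrC divfK // expf_neq0.
Qed.

End Holomorphic.

End MeromorphicLemmas.

Import MeromorphicLemmas.

Section MeromorphicField.
Variables (R : realType) (D : complexDomain R).
Local Notation C := R[i].
Local Notation F := (meromorphic D).
Implicit Types (f g : C -> C) (u v w : F) (x z : C).

Lemma mero_eq u v :
  (forall x, D x -> \forall z \near x^', u z = v z) -> u = v.
Proof.
move=> uv; suff E : mero_fun u = mero_fun v.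
  case: u v E {uv} => [u u1 u2] [v v1 v2] /= E; subst v.
  by congr Meromorphic; exact: Prop_irrelevance.
apply: funext => x; have [Dx|Dx] := pselect (D x); last by rewrite !mero_fun_out.
have uvx := uv x Dx.
have vux : \forall z \near x^', v z = u z by apply: filterS uvx.
case: (mero_funP u Dx) => [ux|[ux u0]]; case: (mero_funP v Dx) => [vx|[vx v0]].
- exact: (analytic_eq_dnbhs (holo_analytic ux) (holo_analytic vx)).
- by case: (holo_pole ux vx uvx).
- by case: (holo_pole vx ux vux).
- by rewrite u0 v0.
Qed.

Lemma mero_mero_at u x : D x -> mero_at u x.
Proof.
by move=> /(mero_funP u) [/holo_mero|[/pole_mero]].
Qed.

Definition holo_extension f x :=
  D x /\ exists g, holomorphic_at g x /\ \forall z \near x^', f z = g z.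

(* Removes the removable singularities of f on D and puts the dummy value 0
   elsewhere. *)
Definition regularize f x : C :=
  if pselect (holo_extension f x) is left H then projT1 (cid H.2) x else 0.

Lemma regularizeE f g x : D x -> holomorphic_at g x ->
  (\forall z \near x^', f z = g z) -> regularize f x = g x.
Proof.
move=> Dx gx fg; rewrite /regularize; case: pselect => [H|[]]; last first.
  by split=> //; exists g.
case: cid => /= h [hx fh].
apply: (analytic_eq_dnbhs (holo_analytic hx) (holo_analytic gx)).
by apply: filterS2 fh fg => z -> .
Qed.

Lemma domain_near x : D x -> \forall z \near x, D z.
Proof. by move=> Dx; apply: open_nbhs_nbhs; split=> //; exact: domain_open. Qed.

Lemma regularize_near f x : D x -> mero_at f x ->
  \forall z \near x^', regularize f z = f z.
Proof.
move=> Dx /mero_holo fx.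
apply: filterS2 (nbhs_weak (domain_near Dx)) fx => y Dy fy.
by apply: regularizeE => //; apply: filterE.
Qed.

Section Build.
Variables (f : C -> C) (fP : forall x, D x -> mero_at f x).

Lemma regularizeP x : D x -> holomorphic_at (regularize f) x \/
  (pole_at (regularize f) x /\ regularize f x = 0).
Proof.
move=> Dx; have near_f := regularize_near Dx (fP Dx).
have [[_ [g [gx fg]]]|next] := pselect (holo_extension f x).
  left; apply: (holo_near _ (gx)); apply: nbhs_split; last first.
    by apply/esym; exact: (regularizeE Dx gx fg).
  by apply: filterS2 near_f fg => z -> ->.
right; split; last by rewrite /regularize; case: pselect.
case: (mero_holo_or_pole (fP Dx)) => [ext|[n [g [gx g0 fg]]]].
  by case: next.
exists n, g; split=> //.
by apply: filterS2 near_f fg => z -> ->.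
Qed.

Lemma regularize_out x : ~ D x -> regularize f x = 0.
Proof. by rewrite /regularize; case: pselect => // -[]. Qed.

Definition mero_build : F := Meromorphic regularizeP regularize_out.

Lemma mero_buildE x : D x -> \forall z \near x^', mero_build z = f z.
Proof. by move=> Dx; apply: regularize_near => //; exact: fP. Qed.

End Build.

Lemma cst_subproof (c : C) x : D x -> mero_at (fun=> c) x.
Proof. by move=> _; exact: holo_mero (holo_cst c x). Qed.

Lemma add_subproof u v x : D x -> mero_at (fun z => u z + v z) x.
Proof. by move=> Dx; apply: meroD; exact: mero_mero_at. Qed.

Lemma opp_subproof u x : D x -> mero_at (fun z => -1 * u z) x.
Proof.
move=> Dx; apply: (meroM (cst_subproof (-1) Dx)); exact: mero_mero_at.
Qed.

Lemma mul_subproof u v x : D x -> mero_at (fun z => u z * v z) x.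
Proof. by move=> Dx; apply: meroM; exact: mero_mero_at. Qed.

Lemma inv_subproof u x : D x -> mero_at (fun z => (u z)^-1) x.
Proof. by move=> Dx; apply: meroV; exact: mero_mero_at. Qed.

(* The operations are the pointwise ones, with removable singularities
   removed. *)
Definition mero_cst c : F := mero_build (@cst_subproof c).
Definition mero_add u v : F := mero_build (@add_subproof u v).
Definition mero_opp u : F := mero_build (@opp_subproof u).
Definition mero_mul u v : F := mero_build (@mul_subproof u v).
Definition mero_inv u : F := mero_build (@inv_subproof u).

Lemma mero_addA : associative mero_add.
Proof.
move=> u v w; apply: mero_eq => x Dx; near=> z.
have -> : mero_add u (mero_add v w) z = u z + mero_add v w z by near: z; exact: mero_buildE.
have -> : mero_add v w z = v z + w z by near: z; exact: mero_buildE.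
have -> : mero_add (mero_add u v) w z = mero_add u v z + w z by near: z; exact: mero_buildE.
have -> : mero_add u v z = u z + v z by near: z; exact: mero_buildE.
exact: addrA.
Unshelve. all: by end_near. Qed.

Lemma mero_addC : commutative mero_add.
Proof.
move=> u v; apply: mero_eq => x Dx; near=> z.
have -> : mero_add u v z = u z + v z by near: z; exact: mero_buildE.
have -> : mero_add v u z = v z + u z by near: z; exact: mero_buildE.
exact: addrC.
Unshelve. all: by end_near. Qed.

Lemma mero_add0 : left_id (mero_cst 0) mero_add.
Proof.
move=> u; apply: mero_eq => x Dx; near=> z.
have -> : mero_add (mero_cst 0) u z = mero_cst 0 z + u z by near: z; exact: mero_buildE.
have -> : mero_cst 0 z = 0 by near: z; exact: mero_buildE.
exact: add0r.
Unshelve. all: by end_near. Qed.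

Lemma mero_addN : left_inverse (mero_cst 0) mero_opp mero_add.
Proof.
move=> u; apply: mero_eq => x Dx; near=> z.
have -> : mero_add (mero_opp u) u z = mero_opp u z + u z by near: z; exact: mero_buildE.
have -> : mero_opp u z = -1 * u z by near: z; exact: mero_buildE.
have -> : mero_cst 0 z = 0 by near: z; exact: mero_buildE.
by rewrite mulN1r addNr.
Unshelve. all: by end_near. Qed.

Lemma mero_mulA : associative mero_mul.
Proof.
move=> u v w; apply: mero_eq => x Dx; near=> z.
have -> : mero_mul u (mero_mul v w) z = u z * mero_mul v w z by near: z; exact: mero_buildE.
have -> : mero_mul v w z = v z * w z by near: z; exact: mero_buildE.
have -> : mero_mul (mero_mul u v) w z = mero_mul u v z * w z by near: z; exact: mero_buildE.
have -> : mero_mul u v z = u z * v z by near: z; exact: mero_buildE.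
exact: mulrA.
Unshelve. all: by end_near. Qed.

Lemma mero_mulC : commutative mero_mul.
Proof.
move=> u v; apply: mero_eq => x Dx; near=> z.
have -> : mero_mul u v z = u z * v z by near: z; exact: mero_buildE.
have -> : mero_mul v u z = v z * u z by near: z; exact: mero_buildE.
exact: mulrC.
Unshelve. all: by end_near. Qed.

Lemma mero_mul1 : left_id (mero_cst 1) mero_mul.
Proof.
move=> u; apply: mero_eq => x Dx; near=> z.
have -> : mero_mul (mero_cst 1) u z = mero_cst 1 z * u z by near: z; exact: mero_buildE.
have -> : mero_cst 1 z = 1 by near: z; exact: mero_buildE.
exact: mul1r.
Unshelve. all: by end_near. Qed.

Lemma mero_mulDl : left_distributive mero_mul mero_add.
Proof.
move=> u v w; apply: mero_eq => x Dx; near=> z.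
have -> : mero_mul (mero_add u v) w z = mero_add u v z * w z by near: z; exact: mero_buildE.
have -> : mero_add u v z = u z + v z by near: z; exact: mero_buildE.
have -> : mero_add (mero_mul u w) (mero_mul v w) z = mero_mul u w z + mero_mul v w z.
  by near: z; exact: mero_buildE.
have -> : mero_mul u w z = u z * w z by near: z; exact: mero_buildE.
have -> : mero_mul v w z = v z * w z by near: z; exact: mero_buildE.
exact: mulrDl.
Unshelve. all: by end_near. Qed.

Lemma mero_1_neq0 : mero_cst 1 <> mero_cst 0.
Proof.
move=> E; have [x Dx] := domain_nonempty D.
have [z [z1]] : exists z, mero_cst 1 z = 1 /\ mero_cst 0 z = 0.
  apply: (@dnbhs_ex _ x).
  by apply: filterS2 (mero_buildE (@cst_subproof 1) Dx)
                     (mero_buildE (@cst_subproof 0) Dx).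
by rewrite -E z1 => /eqP; rewrite oner_eq0.
Qed.

Lemma mero_zero_or_not u x : D x ->
  (\forall z \near x^', u z = 0) \/ (\forall z \near x^', u z != 0).
Proof.
move=> /(mero_mero_at u) /mero_factor [|[k [n [h [hx h0 uh]]]]]; first by left.
right; have := nbhs_weak (analytic_neq0 (holo_analytic hx) h0).
apply: filterS3 uh (dnbhs_neq x) => z ->; rewrite -subr_eq0 => zx hz.
by rewrite !mulf_neq0 ?invr_eq0 ?expf_neq0.
Qed.

Lemma mero_identity u : u <> mero_cst 0 ->
  forall x, D x -> \forall z \near x^', u z != 0.
Proof.
move=> u0 x Dx; case: (mero_zero_or_not u Dx) => // ux; exfalso; apply: u0.
pose A := [set y | D y /\ \forall z \near y^', u z = 0].
have AD : A = domain_set D.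
  apply: (@domain_connected R D A); first by exists x.
  - exists A; last by apply/seteqP; split=> [y [Dy ?]|y []].
    rewrite openE => y [Dy uy]; rewrite /interior.
    apply: nbhs_split => //.
    apply: filterS2 (nbhs_weak (domain_near Dy)) (near_dnbhs uy) => z Dz uz.
    by split; [exact: Dz | exact: (nbhs_weak uz)].
  - exists (~` [set y | D y /\ \forall z \near y^', u z != 0]); last first.
      apply/seteqP; split=> [y [Dy uy]|y [Dy /= ny]]; last first.
        split; first exact: Dy.
        case: (mero_zero_or_not u Dy) => uy; first exact: uy.
        by case: ny; split; [exact: Dy | exact: uy].
      split; first exact: Dy.
      move=> [_ nuy].
      have [z [z0]] : exists z, u z = 0 /\ u z != 0.
        by apply: (@dnbhs_ex _ y); apply: filterS2 uy nuy.
      by rewrite z0 eqxx.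
    apply: open_closedC; rewrite openE => y [Dy uy]; rewrite /interior.
    apply: nbhs_split => //.
    apply: filterS2 (nbhs_weak (domain_near Dy)) (near_dnbhs uy) => z Dz uz.
    by split; [exact: Dz | exact: (nbhs_weak uz)].
apply: mero_eq => y Dy; have [_ uy] : A y by rewrite AD.
apply: filterS2 uy (mero_buildE (@cst_subproof 0) Dy) => z -> E.
exact: esym.
Qed.

Lemma mero_mulV u : u <> mero_cst 0 -> mero_mul (mero_inv u) u = mero_cst 1.
Proof.
move=> u0; apply: mero_eq => x Dx; near=> z.
have -> : mero_mul (mero_inv u) u z = mero_inv u z * u z by near: z; exact: mero_buildE.
have -> : mero_inv u z = (u z)^-1 by near: z; exact: mero_buildE.
have -> : mero_cst 1 z = 1 by near: z; exact: mero_buildE.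
by rewrite mulVf //; near: z; exact: mero_identity.
Unshelve. all: by end_near. Qed.

Lemma mero_inv0 : mero_inv (mero_cst 0) = mero_cst 0.
Proof.
apply: mero_eq => x Dx; near=> z.
have -> : mero_inv (mero_cst 0) z = (mero_cst 0 z)^-1 by near: z; exact: mero_buildE.
have -> : mero_cst 0 z = 0 by near: z; exact: mero_buildE.
exact: invr0.
Unshelve. all: by end_near. Qed.

HB.instance Definition _ := gen_eqMixin F.
HB.instance Definition _ := gen_choiceMixin F.
HB.instance Definition _ :=
  GRing.isZmodule.Build F mero_addA mero_addC mero_add0 mero_addN.

Fact mero_1_neq0' : mero_cst 1 != 0 :> F.
Proof. by apply/eqP; exact: mero_1_neq0. Qed.

HB.instance Definition _ :=
  GRing.Zmodule_isComNzRing.Build F mero_mulA mero_mulC mero_mul1 mero_mulDl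
    mero_1_neq0'.

Fact mero_mulV' u : u != 0 -> mero_inv u * u = 1.
Proof. by move=> /eqP; exact: mero_mulV. Qed.

HB.instance Definition _ :=
  GRing.ComNzRing_isField.Build F mero_mulV' mero_inv0.

(* Away from poles the field operations are the pointwise ones. *)
Lemma mero_addE u v x : D x -> holomorphic_at u x -> holomorphic_at v x ->
  (u + v) x = u x + v x.
Proof.
move=> Dx ux vx; apply: regularizeE Dx (holoD ux vx) _; exact: filterE.
Qed.

Lemma mero_mulE u v x : D x -> holomorphic_at u x -> holomorphic_at v x ->
  (u * v) x = u x * v x.
Proof.
move=> Dx ux vx; apply: regularizeE Dx (holoM ux vx) _; exact: filterE.
Qed.

End MeromorphicField.

Section LatentRoots.
Variables (R : realType) (D : complexDomain R).
Local Notation F := (meromorphic D).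

Definition mx_pole p q (Z : 'M[F]_(p, q)) (x : R[i]) : Prop :=
  exists i j, pole_at (Z i j) x.

Definition pole_set n r (f : F) (M : 'M[F]_r) (X Y : 'M[F]_n) (a : {poly F}) :
    set R[i] :=
  [set x | D x /\ (pole_at f x \/ mx_pole M x \/ mx_pole X x \/ mx_pole Y x \/
                   exists k, pole_at a`_k x)].

Definition pole_free n r (f : F) (M : 'M[F]_r) (X Y : 'M[F]_n) (a : {poly F}) :
    set R[i] :=
  [set x | D x] `\` pole_set f M X Y a.

Definition mx_eval p q (Z : 'M[F]_(p, q)) (x : R[i]) : 'M[R[i]]_(p, q) :=
  map_mx (fun h : F => h x) Z.

Definition latent_root r (DP : set R[i]) (Z : 'M[F]_r) (x : R[i]) : Prop :=
  DP x /\ \det (mx_eval Z x) = 0.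

Definition root_of (DP : set R[i]) (h : F) (x : R[i]) : Prop :=
  DP x /\ h x = 0.

End LatentRoots.

Definition pmx (F : fieldType) n (f : F) (Z : 'M[F]_n.+1) (a : {poly F}) :
    'M[F]_n.+1 :=
  \sum_(1 <= k < size a)
    a`_k *: \sum_(1 <= i < k.+1) f ^+ (i - 1) *: Z ^+ (k - i).

(* Main.v *)
(* With Z = f I - X A Y, the matrix p(f, Z; a) is the divided difference
   (a(f) I - a(Z)) / (f I - Z), so a(Z) = 0 gives X A Y p(f, Z; a) = a(f) I and,
   after cancelling X, the key identity A P = a(f) I. Thus P plays the role of
   a(f) A^-1 and S that of a(f) times the Schur complement of A in M, even where
   A is singular. Multiplying M on the right by the block triangular matrix
   ((I, -P B), (0, a(f) I)) gives det M * a(f)^s = det A * det S. The functions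
   holomorphic at a point l of D form a subring of F on which evaluation at l is
   a ring morphism. For l in D_P this subring contains f and all entries and
   coefficients involved, so A P = a(f) I and the definition of S hold at l, and
   the claims become statements about complex matrices. *)
Require Import Defs.
From HB Require Import structures.
From mathcomp Require Import all_boot all_order all_algebra.
From mathcomp Require Import all_classical all_reals all_analysis.
From mathcomp Require Import complex.

Set Implicit Arguments.
Unset Strict Implicit.
Unset Printing Implicit Defensive.

Import GRing.Theory.
Import MeromorphicLemmas.
Local Open Scope ring_scope.

Lemma horner_mx_coef (R : comNzRingType) n (Z : 'M[R]_n.+1) (a : {poly R}) :
  horner_mx Z a = \sum_(0 <= k < size a) a`_k *: Z ^+ k.
Proof.
rewrite -{1}[a]coefK poly_def linear_sum /= big_mkord.
by apply: eq_bigr => k _; rewrite horner_mxZ rmorphXn /= horner_mx_X.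
Qed.

Lemma subXX_scalar_mx (R : comNzRingType) n (f : R) (Z : 'M[R]_n.+1) k :
  (f%:M - Z) *m (\sum_(1 <= i < k.+1) f ^+ (i - 1) *: Z ^+ (k - i)) =
  (f ^+ k)%:M - Z ^+ k.
Proof.
rewrite rmorphXn -opprB mulNmx -[RHS]opprB; congr (- _).
rewrite (subrXX_comm k (comm_mx_scalar f Z)) mulmxE; congr (_ * _).
rewrite big_add1 big_mkord; apply: eq_bigr => i _.
by rewrite subSS subn0 subnS -predn_sub -rmorphXn -mulmxE /= mul_mx_scalar.
Qed.

Lemma mul_sub_pmx (F : fieldType) n (f : F) (Z : 'M[F]_n.+1) (a : {poly F}) :
  (f%:M - Z) *m pmx f Z a = a.[f]%:M - horner_mx Z a.
Proof.
rewrite horner_mx_coef horner_coef rmorph_sum /=.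
rewrite -(big_mkord xpredT (fun k => (a`_k * f ^+ k)%:M)) -sumrB /pmx.
have term k : (f%:M - Z) *m
    (a`_k *: \sum_(1 <= i < k.+1) f ^+ (i - 1) *: Z ^+ (k - i)) =
    (a`_k * f ^+ k)%:M - a`_k *: Z ^+ k.
  by rewrite -scalemxAr subXX_scalar_mx scalerBr scale_scalar_mx.
rewrite mulmx_sumr; under eq_bigr do rewrite term.
have [->|a_gt0] := posnP (size a); first by rewrite !big_geq.
by rewrite [RHS]big_ltn // expr0 mulr1 expr0 -scalemx1 subrr add0r.
Qed.

Lemma mulmx_pmx_annihilated (F : fieldType) n (f : F) (A X Y : 'M[F]_n.+1)
    (a : {poly F}) :
  X \in unitmx -> horner_mx (f%:M - X *m A *m Y) a = 0 ->
  A *m (Y *m pmx f (f%:M - X *m A *m Y) a *m X) = a.[f]%:M.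
Proof.
move=> unitX annih; have := mul_sub_pmx f (f%:M - X *m A *m Y) a.
rewrite annih subr0 subKr => XAYp; apply: (can_inj (mulKmx unitX)).
by rewrite !mulmxA XAYp scalar_mxC.
Qed.

Lemma det_block_scaled_schur (R : comNzRingType) n s (A P : 'M[R]_n)
    (B : 'M[R]_(n, s)) (C : 'M[R]_(s, n)) (E : 'M[R]_s) (c : R) :
  A *m P = c%:M ->
  \det (block_mx A B C E) * c ^+ s = \det A * \det (c *: E - C *m P *m B).
Proof.
move=> AP.
have <- : \det (block_mx 1%:M (- (P *m B)) 0 c%:M) = c ^+ s.
  by rewrite det_ublock det1 mul1r det_scalar.
rewrite -det_mulmx mulmx_block !mulmx1 !mulmx0 !addr0 !mulmxN !mulmxA AP.
by rewrite mul_scalar_mx !mul_mx_scalar addNr det_lblock addrC.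
Qed.

Section ScaledSchurSingular.
Variables (K : idomainType) (n s : nat) (A P : 'M[K]_n).
Variables (B : 'M[K]_(n, s)) (C : 'M[K]_(s, n)) (E : 'M[K]_s) (c : K).
Hypothesis AP : A *m P = c%:M.

Lemma det_eq0_scale : \det A = 0 -> c = 0.
Proof.
move=> detA; have /eqP : c ^+ n = 0.
  by rewrite -det_scalar -AP det_mulmx detA mul0r.
by rewrite expf_eq0 => /andP[_ /eqP].
Qed.

Lemma det_block_eq0 : \det (block_mx A B C E) = 0 ->
  \det (c *: E - C *m P *m B) = 0 \/ \det A = 0.
Proof.
move=> detM; have /esym/eqP := det_block_scaled_schur B C E AP.
by rewrite detM mul0r mulf_eq0 => /orP[] /eqP; [right | left].
Qed.

Lemma det_scaled_schur_eq0 : \det (c *: E - C *m P *m B) = 0 ->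
  c <> 0 -> \det (block_mx A B C E) = 0.
Proof.
move=> detS c_neq0; have /eqP := det_block_scaled_schur B C E AP.
by rewrite detS mulr0 mulf_eq0 expf_eq0 => /orP[/eqP | /andP[_ /eqP]].
Qed.

End ScaledSchurSingular.

Lemma mxOver_block (T : Type) (S : {pred T}) m1 m2 n1 n2 (A : 'M[T]_(m1, n1))
    (B : 'M[T]_(m1, n2)) (C : 'M[T]_(m2, n1)) (E : 'M[T]_(m2, n2)) :
  block_mx A B C E \is a mxOver S ->
  [/\ A \is a mxOver S, B \is a mxOver S, C \is a mxOver S & E \is a mxOver S].
Proof.
move=> /mxOverP MS; split; apply/mxOverP => i j.
- by rewrite -(block_mxEul A B C E).
- by rewrite -(block_mxEur A B C E).
- by rewrite -(block_mxEdl A B C E).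
- by rewrite -(block_mxEdr A B C E).
Qed.

Lemma mxOver_map_val (T : Type) (S : {pred T}) (U : subType (mem S)) m n
    (Z : 'M[T]_(m, n)) :
  Z \is a mxOver S -> exists Z' : 'M[U]_(m, n), Z = map_mx val Z'.
Proof.
move=> /mxOverP ZS; exists (\matrix_(i, j) Sub (Z i j) (ZS i j)).
by apply/matrixP => i j; rewrite !mxE SubK.
Qed.

Lemma inj_map_mx (T U : Type) (g : T -> U) m n :
  injective g -> injective (map_mx g : 'M[T]_(m, n) -> 'M[U]_(m, n)).
Proof.
move=> g_inj Z W /matrixP gZW; apply/matrixP => i j; apply: g_inj.
by have := gZW i j; rewrite !mxE.
Qed.

Lemma mxOver_pmx (F : fieldType) (S : subringClosed F) n (f : F)
    (Z : 'M[F]_n.+1) (a : {poly F}) :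
  f \in S -> Z \is a mxOver S -> a \is a polyOver S ->
  pmx f Z a \is a mxOver S.
Proof.
move=> fS ZS /polyOverP aS; apply: rpred_sum => k _; apply: mxOverZ => //.
by apply: rpred_sum => i _; apply: mxOverZ; rewrite rpredX.
Qed.

Lemma mxOver_mul_pmx (F : fieldType) (S : subringClosed F) n (f : F)
    (A X Y : 'M[F]_n.+1) (a : {poly F}) :
  f \in S -> a \is a polyOver S ->
  A \is a mxOver S -> X \is a mxOver S -> Y \is a mxOver S ->
  Y *m pmx f (f%:M - X *m A *m Y) a *m X \is a mxOver S.
Proof.
move=> fS aS AS XS YS.
have ZS : f%:M - X *m A *m Y \is a mxOver S.
  apply: rpredB; last exact: mxOverM (mxOverM XS AS) YS.
  by apply: mxOver_scalar fS; exact: rpred0.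
exact: mxOverM (mxOverM YS (mxOver_pmx fS ZS aS)) XS.
Qed.

Section HolomorphicRing.
Variables (R : realType) (D : complexDomain R).
Local Notation F := (meromorphic D).

Lemma mero_build_val (g : R[i] -> R[i]) (gP : forall x, D x -> mero_at g x) x :
  D x -> holomorphic_at g x -> mero_build gP x = g x.
Proof. by move=> Dx gx; apply: regularizeE => //; exact: filterE. Qed.

Lemma mero_build_holo (g : R[i] -> R[i]) (gP : forall x, D x -> mero_at g x) x :
  D x -> holomorphic_at g x -> holomorphic_at (mero_build gP) x.
Proof.
move=> Dx gx; apply: (holo_near _ gx).
apply: filterS2 (domain_near Dx) (near_nbhs gx) => y Dy gy.
by rewrite mero_build_val.
Qed.

Variables (x : R[i]) (Dx : D x).

(* The proof of [D x] is an index so that the instances below, whose laws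
   need x to lie in D, carry no side condition. *)
Definition holo of D x : {pred F} := [pred h : F | `[< holomorphic_at h x >]].

Lemma holoP (h : F) : reflect (holomorphic_at h x) (h \in holo Dx).
Proof. exact: asboolP. Qed.

Fact holo_subring_closed : subring_closed (holo Dx).
Proof.
split=> [|u v /holoP ux /holoP vx|u v /holoP ux /holoP vx]; apply/holoP.
- exact: mero_build_holo Dx (holo_cst 1 x).
- apply: mero_build_holo Dx (holoD ux _).
  exact: mero_build_holo Dx (holoM (holo_cst (-1) x) vx).
- exact: mero_build_holo Dx (holoM ux vx).
Qed.

HB.instance Definition _ :=
  GRing.isSubringClosed.Build F (holo Dx) holo_subring_closed.

Record holo_ring := HoloRing { holo_fun : F; _ : holo_fun \in holo Dx }.

HB.instance Definition _ := [isSub for holo_fun].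
HB.instance Definition _ := [Choice of holo_ring by <:].
HB.instance Definition _ := [SubChoice_isSubComNzRing of holo_ring by <:].

Definition holo_eval (h : holo_ring) : R[i] := val h x.

Fact holo_eval_zmod_morphism : zmod_morphism holo_eval.
Proof.
have evalD u v : holo_eval (u + v) = holo_eval u + holo_eval v.
  by apply: mero_addE => //; apply/holoP; exact: valP.
by move=> u v; apply: (addIr (holo_eval v)); rewrite -evalD !subrK.
Qed.

Fact holo_eval_monoid_morphism : monoid_morphism holo_eval.
Proof.
split=> [|u v]; first exact: mero_build_val Dx (holo_cst 1 x).
by apply: mero_mulE => //; apply/holoP; exact: valP.
Qed.

HB.instance Definition _ :=
  GRing.isZmodMorphism.Build holo_ring R[i] holo_eval holo_eval_zmod_morphism.
HB.instance Definition _ :=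
  GRing.isMonoidMorphism.Build holo_ring R[i] holo_eval
    holo_eval_monoid_morphism.

Lemma mx_eval_val m n (Z : 'M[holo_ring]_(m, n)) :
  mx_eval (map_mx val Z) x = map_mx holo_eval Z.
Proof. by rewrite /mx_eval -map_mx_comp. Qed.

Lemma holo_no_pole (h : F) : ~ pole_at h x -> h \in holo Dx.
Proof. by move=> no_pole; apply/holoP; case: (mero_funP h Dx) => [|[]]. Qed.

Lemma mxOver_holo_no_pole m n (Z : 'M[F]_(m, n)) :
  ~ mx_pole Z x -> Z \is a mxOver (holo Dx).
Proof.
move=> no_pole; apply/mxOverP => i j; apply: holo_no_pole => pole_ij.
by apply: no_pole; exists i, j.
Qed.

Lemma mx_eval_scaled_schur n s (A P : 'M[F]_n) (B : 'M[F]_(n, s))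
    (C : 'M[F]_(s, n)) (E : 'M[F]_s) (c : F) :
  block_mx A B C E \is a mxOver (holo Dx) -> P \is a mxOver (holo Dx) ->
  c \in holo Dx -> A *m P = c%:M ->
  mx_eval A x *m mx_eval P x = (c x)%:M /\
  mx_eval (c *: E - C *m P *m B) x =
    c x *: mx_eval E x - mx_eval C x *m mx_eval P x *m mx_eval B x.
Proof.
move=> /mxOver_block[AH BH CH EH] PH cH.
have [A' ->] := mxOver_map_val holo_ring AH.
have [B' ->] := mxOver_map_val holo_ring BH.
have [C' ->] := mxOver_map_val holo_ring CH.
have [E' ->] := mxOver_map_val holo_ring EH.
have [P' ->] := mxOver_map_val holo_ring PH.
rewrite -[c]/(val (HoloRing cH)); set c' := HoloRing cH => AP.
have {}AP : A' *m P' = c'%:M.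
  by apply: (inj_map_mx val_inj); rewrite map_mxM map_scalar_mx.
rewrite -!map_mxM -map_mxZ -map_mxB !mx_eval_val -map_mxM AP map_scalar_mx.
by rewrite map_mxB map_mxZ !map_mxM.
Qed.

End HolomorphicRing.

Lemma pole_free_holo (R : realType) (D : complexDomain R) n r
    (f : meromorphic D) (M : 'M[meromorphic D]_r) (X Y : 'M[meromorphic D]_n)
    (a : {poly meromorphic D}) (x : R[i]) :
  pole_free f M X Y a x -> exists Dx : D x,
  [/\ f \in holo Dx, M \is a mxOver (holo Dx), X \is a mxOver (holo Dx),
      Y \is a mxOver (holo Dx) & a \is a polyOver (holo Dx)].
Proof.
move=> [Dx not_pole]; exists Dx; split.
- by apply: holo_no_pole => fx; apply: not_pole; split=> //; left.
- apply: mxOver_holo_no_pole => Mx; apply: not_pole; split=> //.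
  by right; left.
- apply: mxOver_holo_no_pole => Xx; apply: not_pole; split=> //.
  by right; right; left.
- apply: mxOver_holo_no_pole => Yx; apply: not_pole; split=> //.
  by right; right; right; left.
- apply/polyOverP => k; apply: holo_no_pole => ax; apply: not_pole; split=> //.
  by right; right; right; right; exists k.
Qed.

Theorem corollary2 (R : realType) (D : complexDomain R) (n s : nat)
    (A : 'M[meromorphic D]_n.+1) (B : 'M[meromorphic D]_(n.+1, s.+1))
    (C : 'M[meromorphic D]_(s.+1, n.+1)) (E : 'M[meromorphic D]_s.+1)
    (X Y : 'M[meromorphic D]_n.+1)
    (f : meromorphic D) (a : {poly meromorphic D})
    (hX : X \in unitmx) (hY : Y \in unitmx) (ha : a != 0)
    (haf : horner_mx (f%:M - X *m A *m Y) a = 0) :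
  let M := block_mx A B C E in
  let P := Y *m pmx f (f%:M - X *m A *m Y) a *m X in
  let S := a.[f] *: E - C *m P *m B in
  let DP := pole_free f M X Y a in
  [/\ forall l : R[i], latent_root DP A l -> root_of DP a.[f] l,
      forall l : R[i], latent_root DP M l ->
        latent_root DP S l \/ latent_root DP A l
    & forall l : R[i], latent_root DP S l -> ~ root_of DP a.[f] l ->
        latent_root DP M l].
Proof.
move=> M P S DP.
have AP : A *m P = a.[f]%:M by exact: mulmx_pmx_annihilated.
have eval_block l : mx_eval M l =
    block_mx (mx_eval A l) (mx_eval B l) (mx_eval C l) (mx_eval E l).
  exact: map_block_mx.
have eval_relations l : DP l ->
    mx_eval A l *m mx_eval P l = (a.[f] l)%:M /\
    mx_eval S l = a.[f] l *: mx_eval E l -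
      mx_eval C l *m mx_eval P l *m mx_eval B l.
  move=> /pole_free_holo[Dl [fH MH XH YH aH]].
  have [AH _ _ _] := mxOver_block MH.
  have PH : P \is a mxOver (holo Dl) := mxOver_mul_pmx fH aH AH XH YH.
  exact: mx_eval_scaled_schur MH PH (rpred_horner aH fH) AP.
split=> l [DPl]; have [APl Sl] := eval_relations l DPl.
- by move=> /(det_eq0_scale APl).
- rewrite eval_block /latent_root Sl => /(det_block_eq0 APl).
  by case; [left | right].
- rewrite Sl => detS not_root; split=> //; rewrite eval_block.
  by apply: det_scaled_schur_eq0 APl detS _ => afl; apply: not_root.
Qed.
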